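(* Let $n_1,n_2\ge1$ be integers. Let $X_1,\ldots,X_{n_1}$ be i.i.d. real random variables with the law of $X$ and, independently, let $Y_1,\ldots,Y_{n_2}$ be i.i.d. real random variables with the law of $Y$, where $X$ and $Y$ are independent. Suppose the laws of $X$ and $Y$ are continuous, let $\theta=P(X<Y)$, and let $$\widehat\theta_{n_1,n_2}=\frac{1}{n_1n_2}\sum_{i=1}^{n_1}\sum_{j=1}^{n_2}\mathbf{1}\{X_i<Y_j\}$$ be the Mann--Whitney statistic. Then for all $t>0$, $$P\left(|\widehat\theta_{n_1,n_2}-\theta|\ge t\right)\le 2\exp\left(-2\min(n_1,n_2)\,t^2\right),$$ and for every $\delta\in(0,1)$, with probability at least $1-\delta$, $$|\widehat\theta_{n_1,n_2}-\theta|\le\sqrt{\frac{\log(2/\delta)}{2\min(n_1,n_2)}}.$$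
   Context: A law on $\mathbb{R}$ is continuous if it has no atoms (its distribution function is continuous). *)

(* Defs.v *)
From HB Require Import structures.
From mathcomp Require Import all_boot all_order all_algebra.
From mathcomp Require Import all_classical all_reals all_analysis.
Set Implicit Arguments.
Unset Strict Implicit.
Unset Printing Implicit Defensive.
Import Order.TTheory GRing.Theory Num.Theory.
Import numFieldNormedType.Exports.
Local Open Scope classical_set_scope.
Local Open Scope ring_scope.

Section probability_notions.
Context (R : realType).

Definition atomless (mu : set R -> \bar R) : Prop :=
  forall x : R, mu [set x] = 0%E.

(* Two laws are compared on Borel sets only: the values of a measure on other
   sets carry no information. *)
Definition same_law (mu nu : set R -> \bar R) : Prop :=
  forall B : set R, measurable B -> mu B = nu B.

Context (d : measure_display) (T : measurableType d) (P : probability T R).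

Definition independent_RV2 (X Y : {RV P >-> R}) : Prop :=
  forall A B : set R, measurable A -> measurable B ->
    P (X @^-1` A `&` Y @^-1` B) = (P (X @^-1` A) * P (Y @^-1` B))%E.

Definition mutually_independent (I : finType) (X : I -> {RV P >-> R}) : Prop :=
  forall (J : {set I}) (B : I -> set R), (forall i, measurable (B i)) ->
    P (\bigcap_(i in [set` J]) X i @^-1` B i) =
    (\prod_(i in J) P (X i @^-1` B i))%E.

Definition iid_with_law (mu : set R -> \bar R) (I : finType)
    (X : I -> {RV P >-> R}) : Prop :=
  mutually_independent X /\ forall i, same_law (distribution P (X i)) mu.

Definition independent_families m n
    (X : 'I_m -> {RV P >-> R}) (Y : 'I_n -> {RV P >-> R}) : Prop :=
  forall A B : set T,
    g_sigma_preimage (fun i w => X i w) A ->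
    g_sigma_preimage (fun j w => Y j w) B ->
    P (A `&` B) = (P A * P B)%E.

Definition mann_whitney n1 n2
    (X : 'I_n1 -> {RV P >-> R}) (Y : 'I_n2 -> {RV P >-> R}) (w : T) : R :=
  (n1 * n2)%N%:R^-1 * \sum_(i < n1) \sum_(j < n2) \1_[set u | X i u < Y j u] w.

End probability_notions.

(* Main.v *)
Require Import Defs.
From mathcomp Require Import all_boot all_order all_algebra.
From mathcomp Require Import all_classical all_reals all_analysis.
From mathcomp Require Import measurable_realfun ring lra.
Set Implicit Arguments.
Unset Strict Implicit.
Unset Printing Implicit Defensive.
Import Order.TTheory GRing.Theory Num.Theory.
Import numFieldNormedType.Exports.
Local Open Scope classical_set_scope.
Local Open Scope ring_scope.

(** The double sum is not a sum of independent variables, but it is an average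
    of such sums.  Let m = min(n1, n2).  Match every index of the shorter
    sample with an index of the longer one, and rotate this matching
    cyclically: every pair (i, j) is then used equally often
    ([average_of_matchings]), so the statistic is the mean, over the rotations,
    of the frequencies (1/m) * (number of matched pairs with X < Y).  Within a
    single matching no observation occurs twice, so the m matched pairs are
    independent with the law of (X, Y) ([matched_pairs_independent]), and the
    number of successes has the binomial moment generating function
    ([matched_pairs_mgf]).

    By convexity of the exponential ([expR_mean_le]) the moment generating
    function of the statistic is at most the mean of those of the matchings,
    however dependent the matchings are on one another.  Hoeffding's lemma for
    a Bernoulli variable ([bernoulli_mgf_le]) bounds it by
    exp(s theta + s^2 / (8 m)) ([two_sample_mgf_le]).  Chernoff's inequality at
    s = 4 m t for each tail gives the factor 2 exp(- 2 m t^2)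
    ([two_sample_deviation]); the confidence statement is the same bound at the
    t for which it equals delta.

    The argument is carried out for the indicator of an arbitrary measurable
    set C of the plane in place of the half-plane x < y. *)

(** * Exponential inequalities *)

Lemma ge0_is_derive_ndecr (R : realType) (f f' : R -> R) :
  (forall x, is_derive x (1 : R) f (f' x)) -> (forall x, 0 < x -> 0 <= f' x) ->
  forall x, 0 <= x -> f 0 <= f x.
Proof.
move=> df f'0 x x0; apply: (@ger0_derive1_ndecry R f 0) => //.
- by move=> y; rewrite in_itv/= andbT derive1E derive_val; exact: f'0.
- by apply: derivable_within_continuous => y _; apply: ex_derive.
Qed.

(** Write phi(x) for the difference of the logarithms of the two sides.  It
    vanishes at 0, and so does its derivative psi; the derivative of psi is
    1/4 - q (1 - q), where q is the weight of success after exponential tilting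
    by x, and this is nonnegative.  Hence psi, then phi, is nonnegative. *)
Lemma bernoulli_mgf_le_pos (R : realType) (p s : R) : 0 <= p <= 1 -> 0 <= s ->
  1 - p + p * expR s <= expR (s * p + s ^+ 2 / 8).
Proof.
move=> /andP[p0 p1] s0.
pose D (x : R) := 1 - p + p * expR x.
have D0 x : 0 < D x.
  rewrite /D; have := expR_gt0 x; case: (ltP p 1) => ? ?; first nra.
  have -> : p = 1 by lra.
  lra.
pose psi (x : R) := p + x / 4 - p * expR x / D x.
pose psi' (x : R) := 4^-1 - (1 - p) * (p * expR x) / D x ^+ 2.
have dD x : is_derive x (1 : R) D (p * expR x).
  by apply: is_derive_eq; rewrite add0r mul1r.
have dpsi x : is_derive x (1 : R) psi (psi' x).
  have dV := is_deriveV (lt0r_neq0 (D0 x)) (dD x).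
  have dE : is_derive x (1 : R) (fun y : R => p * expR y) (p * expR x).
    by apply: is_derive_eq.
  have dA : is_derive x (1 : R) (fun y : R => p + y / 4) (4^-1).
    apply: is_derive_eq; rewrite !scaler0 /GRing.scale/=; lra.
  apply: (is_derive_eq (is_deriveB dA (is_deriveM dE dV))).
  rewrite /psi' /GRing.scale/= /D; have := lt0r_neq0 (D0 x); rewrite /D => ?.
  by field.
pose phi (x : R) := x * p + x ^+ 2 / 8 - ln (D x).
have dphi x : is_derive x (1 : R) phi (psi x).
  have dl := is_derive1_comp (is_derive1_ln (D0 x)) (dD x).
  have dA : is_derive x (1 : R) (fun y : R => y * p + y ^+ 2 / 8) (p + x / 4).
    apply: is_derive_eq; rewrite !scaler0 /GRing.scale/=; lra.
  apply: (is_derive_eq (is_deriveB dA dl)).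
  by rewrite /psi [X in _ - X]mulrC.
have psi_ge0 x : 0 <= x -> 0 <= psi x.
  move=> x0; have <- : psi 0 = 0.
    by rewrite /psi /D expR0 mulr1 subrK divr1 mul0r addr0 subrr.
  apply: (ge0_is_derive_ndecr dpsi) => // y _.
  rewrite /psi' subr_ge0 ler_pdivrMr ?exprn_gt0//.
  (* 4 u v <= (u + v)^2 with u = 1 - p and v = p e^y *)
  rewrite /D; have := sqr_ge0 (1 - p - p * expR y); lra.
have : phi 0 <= phi s.
  by apply: (ge0_is_derive_ndecr dphi) => // y /ltW; exact: psi_ge0.
rewrite /phi {1}/D expR0 mulr1 subrK ln1 expr0n/= !mul0r addr0 subr0 subr_ge0.
by move=> le_phi; rewrite -[leLHS]lnK ?posrE ?D0// ler_expR.
Qed.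

(** A negative s reduces to a positive one by exchanging success and failure. *)
Lemma bernoulli_mgf_le (R : realType) (p s : R) : 0 <= p <= 1 ->
  1 - p + p * expR s <= expR (s * p + s ^+ 2 / 8).
Proof.
move=> /andP[p0 p1]; case: (leP 0 s) => [|/ltW s0].
  by apply: bernoulli_mgf_le_pos; rewrite p0.
have := @bernoulli_mgf_le_pos R (1 - p) (- s).
rewrite oppr_ge0 s0 subr_ge0 p1 lerBlDr lerDl p0 => /(_ isT isT).
rewrite -(ler_pM2l (expR_gt0 s)) -expRD => H; apply: (le_trans _ (le_trans H _)).
  have E : expR s * expR (- s) = 1 by rewrite -expRD subrr expR0.
  by rewrite mulrDr mulrCA E mulr1; lra.
by rewrite ler_expR; lra.
Qed.

(** Sum the tangent line inequality of the exponential at the mean a: the linear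
    terms cancel. *)
Lemma expR_mean_le (R : realType) n (x : 'I_n -> R) : (0 < n)%N ->
  expR (n%:R^-1 * \sum_i x i) <= n%:R^-1 * \sum_i expR (x i).
Proof.
move=> n0; set a := _ * _; have n0' : 0 < n%:R :> R by rewrite ltr0n.
rewrite ler_pdivlMl//.
have -> : n%:R * expR a = \sum_i (expR a * (1 + (x i - a))).
  rewrite -mulr_sumr mulrC big_split/= sumrB !sumr_const card_ord.
  by rewrite -[a *+ n]mulr_natl /a mulVKf ?lt0r_neq0// subrr addr0.
apply: ler_sum => i _; rewrite -[in leRHS](subrK a (x i)) expRD mulrC.
by rewrite ler_pM2r ?expR_gt0// expR_ge1Dx.
Qed.

(** * Independence of matched pairs *)

Lemma prod_indic (R : comNzRingType) T (I : finType) (F : I -> set T) w :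
  \prod_i \1_(F i) w = \1_(\bigcap_i F i) w :> R.
Proof.
have [Fw|/existsNP[i]] := pselect (forall i, F i w).
  rewrite !indicE mem_set ?big1// => i _.
  by rewrite indicE mem_set.
move=> Fiw; rewrite (bigD1 i)//= !indicE memNset// mul0r memNset//.
by move=> /(_ i Logic.I).
Qed.

Lemma eq_measure_rectangles d1 d2 (T1 : measurableType d1)
    (T2 : measurableType d2) (R : realType)
    (m1 m2 : {measure set (T1 * T2) -> \bar R}) :
  (m1 setT < +oo)%E ->
  (forall A B, measurable A -> measurable B -> m1 (A `*` B) = m2 (A `*` B)) ->
  forall C, measurable C -> m1 C = m2 C.
Proof.
move=> m1oo m12.
apply: (@measure_unique _ _ _
  [set A `*` B | A in measurable & B in measurable] (fun=> setT)) => //.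
- exact: measurable_prod_measurableType.
- move=> _ _ [A mA [B mB <-]] [A' mA' [B' mB' <-]].
  exists (A `&` A'); first exact: measurableI.
  by exists (B `&` B'); [exact: measurableI|rewrite setXI].
- by move=> _; exists setT => //; exists setT => //; rewrite setXTT.
- exact: bigcup_const.
- by move=> _ [A mA [B mB <-]]; exact: m12.
Qed.

Section independence.
Context (R : realType) (d : measure_display) (T : measurableType d)
  (P : probability T R).

(** Apply the product rule to the image under a, with the whole line as the
    constraint on every index outside the range of a. *)
Lemma mutually_independent_inj (I J : finType) (X : J -> {RV P >-> R})
    (a : I -> J) :
  injective a -> mutually_independent X -> mutually_independent (X \o a).
Proof.
move=> a_inj indX K B mB.
pose B' j := if [pick i | a i == j] is Some i then B i else setT.
have B'a i : B' (a i) = B i.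
  rewrite /B'; case: pickP => [i' /eqP/a_inj -> //|/(_ i)].
  by rewrite eqxx.
have mB' j : measurable (B' j) by rewrite /B'; case: pickP.
have := indX (a @: K) B' mB'.
rewrite big_imset/=; last by move=> ? ? _ _; exact: a_inj.
under eq_bigr do rewrite B'a.
move=> <-; congr (P _); apply/seteqP; split=> w /= h.
- by move=> _ /= /imsetP[i iK ->]; rewrite B'a; exact: h.
- by move=> i /= iK; rewrite -B'a; apply: h; exact: imset_f.
Qed.

(** This puts the constraints on the coordinates from one sample, taken together as a
    single event, in the scope of [independent_families]. *)
Lemma bigcap_g_sigma_preimage n (X : 'I_n -> T -> R) (I : finType)
    (a : I -> 'I_n) (B : I -> set R) :
  (forall i, measurable (B i)) ->
  g_sigma_preimage X (\bigcap_i (X (a i) @^-1` B i)).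
Proof.
move=> mB; rewrite /g_sigma_preimage; set G := (X in <<s X >>).
apply: (@fin_bigcap_measurable _ (g_sigma_algebraType G)) => // i _.
apply: sub_sigma_algebra.
rewrite /G (bigD1 (a i))//=; left.
by exists (B i) => //; rewrite setTI.
Qed.

Context (mu1 mu2 : set R -> \bar R) (lam : probability (R * R)%type R).
Hypothesis lamE : forall A B, measurable A -> measurable B ->
  lam (A `*` B) = (mu1 A * mu2 B)%E.
Context (n1 n2 : nat).
Context (X : 'I_n1 -> {RV P >-> R}) (Y : 'I_n2 -> {RV P >-> R}).
Hypotheses (iidX : iid_with_law mu1 X) (iidY : iid_with_law mu2 Y).
Hypothesis indXY : independent_families X Y.
Context (I : finType) (a : I -> 'I_n1) (b : I -> 'I_n2).
Hypotheses (a_inj : injective a) (b_inj : injective b).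

Let Z i w := (X (a i) w, Y (b i) w).

Let mZ i : measurable_fun setT (Z i).
Proof. exact: measurable_fun_pair. Qed.

Lemma iid_bigcap (J : finType) n mu (W : 'I_n -> {RV P >-> R}) (c : J -> 'I_n)
    (B : J -> set R) : injective c -> iid_with_law mu W ->
  (forall i, measurable (B i)) ->
  P (\bigcap_i (W (c i) @^-1` B i)) = (\prod_i mu (B i))%E.
Proof.
move=> c_inj [indW lawW] mB.
have /(_ [set: J]%SET B mB) := mutually_independent_inj c_inj indW.
rewrite (_ : [set` [set: J]%SET] = setT); last first.
  by apply/seteqP; split=> // i _ /=; rewrite inE.
move=> ->; apply: eq_big => [i|i _]; first by rewrite inE.
exact: lawW.
Qed.

Lemma matched_pairs_rectangles (A B : I -> set R) :
  (forall i, measurable (A i)) -> (forall i, measurable (B i)) ->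
  P (\bigcap_i (Z i @^-1` (A i `*` B i))) =
  (\prod_i lam (A i `*` B i))%E.
Proof.
move=> mA mB; under eq_bigr do rewrite lamE//.
rewrite big_split/= -(iid_bigcap a_inj iidX mA) -(iid_bigcap b_inj iidY mB).
rewrite -indXY; [|exact: bigcap_g_sigma_preimage..].
congr (P _); apply/seteqP; split=> w /=.
- by move=> h; split=> i _; case: (h i Logic.I).
- by move=> [hA hB] i _; split; [exact: hA|exact: hB].
Qed.

(** The product rule passes from rectangles to arbitrary measurable sets one
    coordinate at a time: with the other constraints fixed, both sides are
    finite measures of the remaining set, and they agree on rectangles.  The
    list s holds the coordinates already freed. *)
Lemma matched_pairs_independent (C : I -> set (R * R)) :
  (forall i, measurable (C i)) ->
  P (\bigcap_i (Z i @^-1` C i)) = (\prod_i lam (C i))%E.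
Proof.
move=> mC.
suff H (s : seq I) : forall C : I -> set (R * R),
    (forall i, measurable (C i)) ->
    (forall i, i \notin s -> exists A B,
       [/\ measurable A, measurable B & C i = A `*` B]) ->
    P (\bigcap_i (Z i @^-1` C i)) = (\prod_i lam (C i))%E.
  by apply: (H (enum I)) => // i; rewrite mem_enum.
elim: s => [|i0 s IH] {mC}C mC rC.
  have /choice[A /choice[B AB]] : forall i, exists A, exists B,
      [/\ measurable A, measurable B & C i = A `*` B] by move=> i; exact: rC.
  rewrite (_ : C = fun i => A i `*` B i); last first.
    by apply/funext => i; have [] := AB i.
  by apply: matched_pairs_rectangles => i; have [] := AB i.
have lamfin D : measurable D -> lam D \is a fin_num.
  exact: fin_num_measure.
pose c := \prod_(i | i != i0) fine (lam (C i)).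
have c0 : 0 <= c by apply: prodr_ge0 => i _; exact: fine_ge0.
pose G := \bigcap_(i in [set~ i0]) (Z i @^-1` C i).
have mZC i D : measurable D -> measurable (Z i @^-1` D).
  by move=> mD; rewrite -[_ @^-1` _]setTI; exact: mZ.
have mG : measurable G.
  by apply: fin_bigcap_measurable => // i _; exact: mZC.
pose C' D i := if i == i0 then D else C i.
have mC' D : measurable D -> forall i, measurable (C' D i).
  by move=> mD i; rewrite /C'; case: ifP.
have splitP D : \bigcap_i (Z i @^-1` C' D i) = Z i0 @^-1` D `&` G.
  rewrite (bigcap_setD1 i0)// /C' eqxx setTD; congr (_ `&` _).
  by apply: eq_bigcapr => i /= /eqP/negbTE ->.
have splitprod D : measurable D ->
    (\prod_i lam (C' D i) = c%:E * lam D)%E.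
  move=> mD; rewrite (bigD1 i0)//= /C' eqxx muleC -prodEFin.
  congr (_ * _)%E; apply: eq_bigr => i /negbTE ->.
  by rewrite fineK ?lamfin.
have C'C : C' (C i0) = C.
  by apply/funext => i; rewrite /C'; case: eqP => [->|].
(* both sides, as functions of the constraint on coordinate i0, are measures *)
rewrite -[in LHS]C'C -[in RHS]C'C splitP splitprod//.
transitivity (pushforward (mrestr P mG) (Z i0) (C i0)); first by [].
transitivity (mscale (NngNum c0) lam (C i0)); last by [].
apply: eq_measure_rectangles => //.
  rewrite /= /pushforward /mrestr preimage_setT setTI.
  exact: le_lt_trans (probability_le1 P mG) (ltry 1).
move=> A B mA mB; have mAB : measurable (A `*` B) by exact: measurableX.
rewrite -[LHS]/(P (Z i0 @^-1` (A `*` B) `&` G)) -[RHS]/(c%:E * lam (A `*` B))%E.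
rewrite -splitP -splitprod//.
apply: IH; first exact: mC'.
move=> i is0; rewrite /C'; case: eqP => [_|/eqP ii0]; first by exists A, B.
by apply: rC; rewrite inE negb_or ii0.
Qed.

(** Each factor exp(s 1_C) is a combination of the indicators of C and of its
    complement.  Expanding the product over all patterns of successes and
    failures reduces the integral to probabilities of finite intersections,
    which factorize, and the sum over patterns refactors. *)
Lemma matched_pairs_mgf (C : set (R * R)) (s : R) : measurable C ->
  (\int[P]_w (expR (s * \sum_i \1_C (Z i w)))%:E =
   ((1 - fine (lam C) + fine (lam C) * expR s) ^+ #|I|)%:E)%E.
Proof.
move=> mC; set p := fine (lam C).
pose Ce (e : bool) := if e then C else ~` C.
pose wt (e : bool) : R := if e then expR s else 1.
pose q (e : bool) := if e then p else 1 - p.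
have mCe e : measurable (Ce e) by case: e => //; exact: measurableC.
have lamCe e : lam (Ce e) = (q e)%:E.
  have pE : lam C = p%:E by rewrite fineK ?fin_num_measure.
  by case: e => //=; rewrite probability_setC// pE.
have mF (f : {ffun I -> bool}) :
    measurable (\bigcap_i (Z i @^-1` Ce (f i))).
  apply: fin_bigcap_measurable => // i _.
  by rewrite -[_ @^-1` _]setTI; exact: mZ.
have wt0 (f : {ffun I -> bool}) : 0 <= \prod_i wt (f i).
  by apply: prodr_ge0 => i _; rewrite /wt; case: ifP => // _; exact: expR_ge0.
have expand w : expR (s * \sum_i \1_C (Z i w)) =
    \sum_(f : {ffun I -> bool})
      \prod_i wt (f i) * \1_(\bigcap_i (Z i @^-1` Ce (f i))) w.
  transitivity (\prod_i \sum_e wt e * \1_(Ce e) (Z i w)).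
    rewrite mulr_sumr expR_sum; apply: eq_bigr => i _.
    rewrite big_bool/= !indicE in_setC.
    by case: (_ \in _); rewrite ?mulr1 ?mulr0 ?addr0 ?add0r ?expR0.
  rewrite bigA_distr_bigA; apply: eq_bigr => f _.
  by rewrite big_split/= -prod_indic.
under eq_integral do rewrite expand -sumEFin.
rewrite ge0_integral_sum//; last 2 first.
- move=> f; apply/measurable_EFinP; apply: measurable_funM => //.
- by move=> f w _; rewrite lee_fin mulr_ge0.
transitivity (\sum_(f : {ffun I -> bool}) (\prod_i (wt (f i) * q (f i)))%:E)%E.
  apply: eq_bigr => f _; under eq_integral do rewrite EFinM.
  rewrite ge0_integralZl_EFin//; last first.
    exact/measurable_EFinP.
  rewrite integral_indic// setIT.
  transitivity ((\prod_i wt (f i))%:E * \prod_i lam (Ce (f i)))%E.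
    by congr (_ * _)%E; exact: (matched_pairs_independent (fun i => mCe (f i))).
  rewrite (eq_bigr (fun i => (q (f i))%:E)); last by move=> i _; exact: lamCe.
  by rewrite prodEFin -EFinM big_split.
rewrite sumEFin -(bigA_distr_bigA (fun=> fun e => wt e * q e)) prodr_const.
by rewrite big_bool/= mul1r [expR s * _]mulrC addrC.
Qed.

End independence.

(** * Averaging over cyclic matchings *)

(** Matching number k sends i to i + k modulo n; for fixed i, the map k |-> i + k
    is a bijection, so every j is hit exactly once. *)
Lemma cyclic_pairing (V : nmodType) m n : (m <= n)%N -> (0 < n)%N ->
  exists b : 'I_n -> 'I_m -> 'I_n, (forall k, injective (b k)) /\
    forall F : 'I_m -> 'I_n -> V,
      \sum_k \sum_i F i (b k i) = \sum_i \sum_j F i j.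
Proof.
case: n => // n mn _.
exists (fun k i => widen_ord mn i + k); split.
  by move=> k i j /addIr/(congr1 val)/= ij; exact: val_inj.
move=> F; rewrite exchange_big/=; apply: eq_bigr => i _.
by rewrite [RHS](reindex_inj (addrI (widen_ord mn i))).
Qed.

Lemma average_of_matchings (R : numFieldType) n1 n2 :
  (0 < n1)%N -> (0 < n2)%N ->
  exists2 K, (0 < K)%N & 
  exists (a : 'I_K -> 'I_(minn n1 n2) -> 'I_n1) 
         (b : 'I_K -> 'I_(minn n1 n2) -> 'I_n2),
    [/\ forall k, injective (a k), forall k, injective (b k) &
    forall F : 'I_n1 -> 'I_n2 -> R,
      (n1 * n2)%N%:R^-1 * \sum_i \sum_j F i j =
      K%:R^-1 * \sum_k (minn n1 n2)%:R^-1 * \sum_i F (a k i) (b k i)].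
Proof.
move=> n1_gt0 n2_gt0; case: (leqP n1 n2) => [n12|/ltnW n21].
- have [b [b_inj bE]] := cyclic_pairing R n12 n2_gt0.
  exists n2 => //; exists (fun _ i => i), b; split=> // [k|F]; first exact: inj_id.
  by rewrite -mulr_sumr bE mulrA -invfM -natrM mulnC.
- have [a [a_inj aE]] := cyclic_pairing R n21 n1_gt0.
  exists n1 => //; exists a, (fun _ i => i); split=> // [k|F]; first exact: inj_id.
  rewrite -mulr_sumr (aE (fun j i => F i j)) exchange_big/=.
  by rewrite mulrA -invfM -natrM.
Qed.

(** * Deviations of the two-sample statistic *)

Lemma measurable_set_true d (T : measurableType d) (b : T -> bool) :
  measurable_fun setT b -> measurable [set w | b w].
Proof.
by move=> /(_ measurableT [set true]); rewrite setTI; exact.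
Qed.

Section two_sample_statistic.
Context (R : realType) (d : measure_display) (T : measurableType d)
  (P : probability T R).
Context (mu1 mu2 : set R -> \bar R) (lam : probability (R * R)%type R).
Hypothesis lamE : forall A B, measurable A -> measurable B ->
  lam (A `*` B) = (mu1 A * mu2 B)%E.
Context (n1 n2 : nat).
Context (X : 'I_n1 -> {RV P >-> R}) (Y : 'I_n2 -> {RV P >-> R}).
Hypotheses (n1_gt0 : (0 < n1)%N) (n2_gt0 : (0 < n2)%N).
Hypotheses (iidX : iid_with_law mu1 X) (iidY : iid_with_law mu2 Y).
Hypothesis indXY : independent_families X Y.
Context (C : set (R * R)) (mC : measurable C).

Let m := minn n1 n2.
Let p := fine (lam C).
Let U w : R :=
  (n1 * n2)%N%:R^-1 * \sum_i \sum_j \1_C (X i w, Y j w).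

Let m_gt0 : 0 < m%:R :> R.
Proof. by rewrite ltr0n leq_min n1_gt0. Qed.

Let measurable_indic_pair i j :
  measurable_fun setT (fun w => \1_C (X i w, Y j w) : R).
Proof.
by apply: measurableT_comp; [exact: measurable_indic|exact: measurable_fun_pair].
Qed.

Let mU : measurable_fun setT U.
Proof.
apply: measurable_funM => //; apply: measurable_sum => i.
exact: measurable_sum.
Qed.

(** Jensen's inequality is applied pointwise, to the mean over matchings; all
    the matchings then have the same moment generating function, that of a
    binomial frequency. *)
Lemma two_sample_mgf_le (s : R) :
  (\int[P]_w (expR (s * U w))%:E <=
   (expR (s * p + s ^+ 2 / (8 * m%:R)))%:E)%E.
Proof.
have p01 : 0 <= p <= 1.
  rewrite fine_ge0//= -lee_fin fineK ?fin_num_measure//.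
  exact: probability_le1.
have /andP[p0 p1] := p01.
have [K K0 [a [b [a_inj b_inj UE]]]] := average_of_matchings R n1_gt0 n2_gt0.
pose V k w := s / m%:R * \sum_i \1_C (X (a k i) w, Y (b k i) w).
have mV k : measurable_fun setT (fun w => (expR (V k w))%:E).
  apply/measurable_EFinP; apply: measurableT_comp => //.
  by apply: measurable_funM => //; exact: measurable_sum.
have mVK k : measurable_fun setT (fun w => (K%:R^-1)%:E * (expR (V k w))%:E)%E.
  exact: emeasurable_funM.
have Kinv0 : 0 <= K%:R^-1 :> R by rewrite invr_ge0.
apply: (@le_trans _ _
  (\int[P]_w (\sum_k (K%:R^-1)%:E * (expR (V k w))%:E))%E).
  apply: ge0_le_integral => //.
  - apply/measurable_EFinP; apply: measurableT_comp => //.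
    exact: measurable_funM.
  - exact: emeasurable_sum.
  - move=> w _.
    rewrite (_ : (\sum_k _)%E = (K%:R^-1 * \sum_k expR (V k w))%:E); last first.
      by rewrite mulr_sumr -sumEFin.
    rewrite lee_fin (le_trans _ (expR_mean_le (V^~ w) K0))// ler_expR.
    rewrite /U UE mulrCA ler_pM2l ?invr_gt0 ?ltr0n// mulr_sumr.
    by apply: ler_sum => k _; rewrite /V mulrA.
rewrite ge0_integral_sum//.
rewrite (eq_bigr (fun=> (K%:R^-1 * (1 - p + p * expR (s / m%:R)) ^+ m)%:E)%E);
  last first.
  move=> k _; rewrite ge0_integralZl_EFin//.
  have := matched_pairs_mgf lamE iidX iidY indXY (a_inj k) (b_inj k)
    (s / m%:R) mC.
  by rewrite card_ord => ->.
rewrite sumEFin sumr_const card_ord -[_ *+ K]mulr_natl mulVKf ?pnatr_eq0 ?gtn_eqF//.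
have -> : s * p + s ^+ 2 / (8 * m%:R) =
    m%:R * (s / m%:R * p + (s / m%:R) ^+ 2 / 8).
  by field; rewrite lt0r_neq0.
rewrite lee_fin expRM_natl lerXn2r ?nnegrE ?expR_ge0//.
  by rewrite addr_ge0 ?subr_ge0// mulr_ge0// expR_ge0.
exact: bernoulli_mgf_le.
Qed.

Lemma two_sample_deviation (t : R) : 0 < t ->
  (P [set w | (t <= `|U w - p|)%R] <=
   (2 * expR (- 2 * m%:R * t ^+ 2))%:E)%E.
Proof.
move=> t0; pose s := 4 * m%:R * t.
have s0 : 0 < s by rewrite !mulr_gt0.
(* Chernoff's bound; s = 4 m t minimizes - s t + s^2 / (8 m), with minimum
   - 2 m t^2 *)
have tail (f : T -> R) (c : R) : measurable_fun setT f ->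
    (\int[P]_w (expR (s * f w))%:E <=
     (expR (s * (c - t) + s ^+ 2 / (8 * m%:R)))%:E)%E ->
    (P [set w | (c <= f w)%R] <= (expR (- 2 * m%:R * t ^+ 2))%:E)%E.
  move=> mf int_le.
  pose F : {RV P >-> R} := mfun_Sub (mem_set mf).
  apply: (le_trans (chernoff F c s0)).
  rewrite /mmt_gen_fun expectation_def/=.
  apply: (@le_trans _ _ ((expR (s * (c - t) + s ^+ 2 / (8 * m%:R)))%:E
     * (expR (- (s * c)))%:E)%E).
    rewrite lee_wpmul2r ?lee_fin ?expR_ge0//.
    by under eq_integral do rewrite mulrC.
  rewrite -EFinM -expRD lee_fin ler_expR le_eqVlt; apply/orP; left; apply/eqP.
  by rewrite /s; field; rewrite lt0r_neq0.
have upper : (P [set w | (p + t <= U w)%R] <= (expR (- 2 * m%:R * t ^+ 2))%:E)%E.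
  apply: tail => //; rewrite addrK; exact: two_sample_mgf_le.
have lower : (P [set w | (t - p <= - U w)%R] <= (expR (- 2 * m%:R * t ^+ 2))%:E)%E.
  apply: tail; first exact: measurableT_comp.
  have := two_sample_mgf_le (- s).
  under eq_integral do rewrite mulNr -mulrN.
  by rewrite sqrrN mulNr -mulrN addrAC subrr sub0r.
have mlevel (f : T -> R) (c : R) : measurable_fun setT f ->
    measurable [set w | (c <= f w)%R].
  by move=> mf; exact/measurable_set_true/measurable_fun_ler.
have -> : [set w | (t <= `|U w - p|)%R] =
    [set w | (p + t <= U w)%R] `|` [set w | (t - p <= - U w)%R].
  apply/seteqP; split=> w /=; rewrite ler_normr lerBrDl opprB.
    by case/orP=> h; [left|right] => //; lra.
  by case=> h; apply/orP; [left|right] => //; lra.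
apply: (@le_trans _ _ (P [set w | (p + t <= U w)%R] +
                       P [set w | (t - p <= - U w)%R])%E).
  by apply: measureU2; apply: mlevel => //; exact: measurableT_comp.
by rewrite mulrDl mul1r EFinD; exact: leeD.
Qed.

Lemma two_sample_confidence (delta : R) : 0 < delta < 1 ->
  ((1 - delta)%:E <=
   P [set w | (`|U w - p| <= Num.sqrt (ln (2 / delta) / (2 * m%:R)))%R])%E.
Proof.
move=> /andP[d0 d1]; set t := Num.sqrt _.
have ln0 : 0 < ln (2 / delta).
  by rewrite ln_gt0// ltr_pdivlMr// mul1r; lra.
have r0 : 0 < ln (2 / delta) / (2 * m%:R) by rewrite divr_gt0// mulr_gt0.
have t0 : 0 < t by rewrite sqrtr_gt0.
have mf : measurable_fun setT (fun w => `|U w - p|).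
  by apply: measurableT_comp => //; exact: measurable_funB.
have mA : measurable [set w | (t <= `|U w - p|)%R].
  exact/measurable_set_true/measurable_fun_ler.
have mB : measurable [set w | (`|U w - p| <= t)%R].
  exact/measurable_set_true/measurable_fun_ler.
apply: (@le_trans _ _ (P (~` [set w | (t <= `|U w - p|)%R]))); last first.
  apply: le_measure; rewrite ?inE//; first exact: measurableC.
  by move=> w /= /negP; rewrite -ltNge => /ltW.
rewrite probability_setC// EFinB leeB//.
apply: (le_trans (two_sample_deviation t0)).
rewrite lee_fin sqr_sqrtr ?(ltW r0)//.
have -> : - 2 * m%:R * (ln (2 / delta) / (2 * m%:R)) = - ln (2 / delta).
  by field; rewrite lt0r_neq0.
by rewrite expRN lnK ?posrE ?divr_gt0// invf_div mulrC divfK.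
Qed.

End two_sample_statistic.

(** * The Mann-Whitney statistic *)

Theorem corollary5p3 (R : realType)
  (d0 : measure_display) (T0 : measurableType d0) (P0 : probability T0 R)
  (X0 Y0 : {RV P0 >-> R})
  (d : measure_display) (T : measurableType d) (P : probability T R)
  (n1 n2 : nat) (X : 'I_n1 -> {RV P >-> R}) (Y : 'I_n2 -> {RV P >-> R})
  (theta : R) :
  (1 <= n1)%N -> (1 <= n2)%N ->
  independent_RV2 X0 Y0 ->
  atomless (distribution P0 X0) -> atomless (distribution P0 Y0) ->
  iid_with_law (distribution P0 X0) X ->
  iid_with_law (distribution P0 Y0) Y ->
  independent_families X Y ->
  theta = fine (P0 [set w | X0 w < Y0 w]%R) ->
  (forall t : R, 0 < t ->
     (P [set w | (t <= `|mann_whitney X Y w - theta|)%R] <=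
      (2 * expR (- 2 * (minn n1 n2)%:R * t ^+ 2))%:E)%E)
  /\
  (forall delta : R, 0 < delta < 1 ->
     ((1 - delta)%:E <=
      P [set w | (`|mann_whitney X Y w - theta| <=
                  Num.sqrt (ln (2 / delta) / (2 * (minn n1 n2)%:R)))%R])%E).
Proof.
move=> n1_gt0 n2_gt0 indXY0 _ _ iidX iidY indXY ->.
have mZ0 : measurable_fun setT (fun w => (X0 w, Y0 w)).
  exact: measurable_fun_pair.
pose Z0 : {mfun T0 >-> (R * R)%type} := mfun_Sub (mem_set mZ0).
pose C : set (R * R) := [set z | z.1 < z.2].
have mC : measurable C.
  by apply: measurable_set_true; exact: measurable_fun_ltr.
have lamE A B : measurable A -> measurable B ->
    distribution P0 Z0 (A `*` B) =
    (distribution P0 X0 A * distribution P0 Y0 B)%E by exact: indXY0.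
split=> t ht.
- exact: (two_sample_deviation lamE n1_gt0 n2_gt0 iidX iidY indXY mC ht).
- exact: (two_sample_confidence lamE n1_gt0 n2_gt0 iidX iidY indXY mC ht).
Qed.
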